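(* The model category structure of groupoids on $\mathbf{Cat}$ is cartesian closed, i.e. it is a monoidal (closed) model category with respect to the cartesian product of categories.
   Context: $\mathbf{Cat}$ is the category of small categories and $[A,B]$ denotes the functor category. The model category structure of groupoids (groupoidal model structure) $(\mathbf{Cat},\mathbf{Gpd})$ on $\mathbf{Cat}$ has: cofibrations the functors injective on objects; weak equivalences the functors $F:A\to B$ such that $[F,Z]:[B,Z]\to[A,Z]$ is an equivalence of categories for every groupoid $Z$; fibrations the functors with the right lifting property against functors that are both cofibrations and weak equivalences. Cartesian closed means that for cofibrations $u:C\to D$ and $i:X\to Y$, the pushout product $u\,\Box\, i:(D\times X)\coprod_{C\times X}(C\times Y)\to D\times Y$ is a cofibration which is acyclic if either $u$ or $i$ is acyclic. *)

(* Defs.v *)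
From Stdlib Require Import FunctionalExtensionality PropExtensionality.
From Stdlib Require Import ProofIrrelevance ClassicalEpsilon Relations.

Set Implicit Arguments.
Unset Strict Implicit.
Unset Printing Implicit Defensive.

(** * Small categories *)

(* [Category] is monomorphic in its universe: all small categories, including
   the functor categories [fun_cat A B], live at one fixed universe level. *)
Record Category := MkCategory {
  ob :> Type;
  hom : ob -> ob -> Type;
  idm : forall a, hom a a;
  comp : forall a b c, hom b c -> hom a b -> hom a c;
  comp_assoc : forall a b c d (h : hom c d) (g : hom b c) (f : hom a b),
    comp h (comp g f) = comp (comp h g) f;
  comp_idl : forall a b (f : hom a b), comp (idm b) f = f;
  comp_idr : forall a b (f : hom a b), comp f (idm a) = f
}.

Arguments hom {_} _ _.
Arguments idm {_} _.
Arguments comp {_} {_ _ _} _ _.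

Declare Scope cat_scope.
Delimit Scope cat_scope with cat.
Bind Scope cat_scope with Category.
Open Scope cat_scope.

Notation "g '\;o' f" := (comp g f) (at level 40, left associativity) : cat_scope.

Definition inverse_of (A : Category) (a b : A) (f : hom a b) (g : hom b a) : Prop :=
  g \;o f = idm a /\ f \;o g = idm b.

Definition is_iso (A : Category) (a b : A) (f : hom a b) : Prop :=
  exists g : hom b a, inverse_of f g.

Definition isomorphic (A : Category) (a b : A) : Prop :=
  exists f : hom a b, is_iso f.

Definition is_groupoid (A : Category) : Prop :=
  forall (a b : A) (f : hom a b), is_iso f.

Record Functor (A B : Category) := MkFunctor {
  fobj :> A -> B;
  fmap : forall a b, hom a b -> hom (fobj a) (fobj b);
  fmap_id : forall a, fmap (idm a) = idm (fobj a);
  fmap_comp : forall a b c (g : hom b c) (f : hom a b),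
    fmap (g \;o f) = fmap g \;o fmap f
}.

Arguments fmap {_ _} _ {_ _} _.

Definition id_functor (A : Category) : Functor A A :=
  @MkFunctor A A (fun a => a) (fun _ _ f => f)
    (fun _ => eq_refl) (fun _ _ _ _ _ => eq_refl).

Program Definition comp_functor (A B C : Category)
    (G : Functor B C) (F : Functor A B) : Functor A C :=
  @MkFunctor A C (fun a => G (F a)) (fun _ _ f => fmap G (fmap F f)) _ _.
Next Obligation. now rewrite !fmap_id. Qed.
Next Obligation. now rewrite !fmap_comp. Qed.

(* Equality of functors in this file is strict (Leibniz) equality, that is,
   equality of morphisms in the 1-category Cat. *)
Notation "G '\oF' F" := (comp_functor G F) (at level 40, left associativity) : cat_scope.

(** * Functor categories *)

Record NatTrans (A B : Category) (F G : Functor A B) := MkNatTrans {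
  ncomp :> forall a : A, hom (F a) (G a);
  naturality : forall a b (f : hom a b),
    ncomp b \;o fmap F f = fmap G f \;o ncomp a
}.

Lemma nat_trans_ext (A B : Category) (F G : Functor A B) (s t : NatTrans F G) :
  (forall a, s a = t a) -> s = t.
Proof.
destruct s as [s Hs], t as [t Ht]; simpl; intros H.
assert (E : s = t) by (apply functional_extensionality_dep; exact H).
subst t; f_equal; apply proof_irrelevance.
Qed.

Definition nat_id (A B : Category) (F : Functor A B) : NatTrans F F.
Proof.
refine (@MkNatTrans A B F F (fun a => idm (F a)) _).
abstract (intros; now rewrite comp_idl, comp_idr).
Defined.

Definition nat_comp (A B : Category) (F G H : Functor A B)
    (t : NatTrans G H) (s : NatTrans F G) : NatTrans F H.
Proof.
refine (@MkNatTrans A B F H (fun a => t a \;o s a) _).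
abstract (intros a b f;
  now rewrite <- comp_assoc, naturality, comp_assoc, naturality, comp_assoc).
Defined.

Definition fun_cat (A B : Category) : Category.
Proof.
refine (@MkCategory (Functor A B) (@NatTrans A B) (@nat_id A B) (@nat_comp A B) _ _ _).
- abstract (intros; apply nat_trans_ext; intro; apply comp_assoc).
- abstract (intros; apply nat_trans_ext; intro; apply comp_idl).
- abstract (intros; apply nat_trans_ext; intro; apply comp_idr).
Defined.

Definition whisker (A B Z : Category) (F : Functor A B) (G H : Functor B Z)
    (t : NatTrans G H) : NatTrans (G \oF F) (H \oF F).
Proof.
refine (@MkNatTrans A Z (G \oF F) (H \oF F) (fun a => t (F a)) _).
abstract (intros a b f; apply (naturality t)).
Defined.

(* The functor [F, Z] : [B, Z] -> [A, Z]. *)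
Definition precomp (A B : Category) (F : Functor A B) (Z : Category) :
  Functor (fun_cat B Z) (fun_cat A Z).
Proof.
refine (@MkFunctor (fun_cat B Z) (fun_cat A Z)
  (fun G => G \oF F) (fun G H t => whisker F t) _ _).
- abstract (intros; now apply nat_trans_ext).
- abstract (intros; now apply nat_trans_ext).
Defined.

Definition is_equivalence (A B : Category) (F : Functor A B) : Prop :=
  exists G : Functor B A,
    @isomorphic (fun_cat A A) (G \oF F) (id_functor A) /\
    @isomorphic (fun_cat B B) (F \oF G) (id_functor B).

(** * The cartesian closed structure of Cat *)

Definition prod_cat (A B : Category) : Category.
Proof.
refine (@MkCategory (ob A * ob B)
  (fun p q => (hom (fst p) (fst q) * hom (snd p) (snd q))%type)
  (fun p => (idm (fst p), idm (snd p)))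
  (fun p q r g f => (fst g \;o fst f, snd g \;o snd f)) _ _ _).
- abstract (intros; simpl; now rewrite !comp_assoc).
- abstract (intros a b [f g]; simpl; now rewrite !comp_idl).
- abstract (intros a b [f g]; simpl; now rewrite !comp_idr).
Defined.

Notation "A '\xC' B" := (prod_cat A B) (at level 40, left associativity) : cat_scope.

Definition prod_functor (A B A' B' : Category) (F : Functor A A') (G : Functor B B') :
  Functor (A \xC B) (A' \xC B').
Proof.
refine (@MkFunctor (A \xC B) (A' \xC B')
  (fun p => (F (fst p), G (snd p)))
  (fun p q f => (fmap F (fst f), fmap G (snd f))) _ _).
- abstract (intros; simpl; now rewrite !fmap_id).
- abstract (intros; simpl; now rewrite !fmap_comp).
Defined.

Notation "F '\xF' G" := (prod_functor F G) (at level 40, left associativity) : cat_scope.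

Definition terminal_cat : Category.
Proof.
refine (@MkCategory unit (fun _ _ => unit) (fun _ => tt) (fun _ _ _ _ _ => tt) _ _ _).
- abstract reflexivity.
- abstract (now intros a b []).
- abstract (now intros a b []).
Defined.

Definition initial_cat : Category.
Proof.
refine (@MkCategory Empty_set (fun _ _ => unit) (fun _ => tt) (fun _ _ _ _ _ => tt) _ _ _).
- abstract reflexivity.
- abstract (now intros a b []).
- abstract (now intros a b []).
Defined.

Definition from_initial (A : Category) : Functor initial_cat A.
Proof.
refine (@MkFunctor initial_cat A (fun e => match e with end)
  (fun a _ _ => match a with end) _ _).
- abstract (intros []).
- abstract (intros []).
Defined.

(* Evaluation [B, Z] x B -> Z, sending (t, f) : (G, b) -> (H, c) to
   t_c . G f. *)
Definition eval_functor (B Z : Category) : Functor (fun_cat B Z \xC B) Z.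
Proof.
refine (@MkFunctor (fun_cat B Z \xC B) Z
  (fun p => fobj (fst p) (snd p))
  (fun p q f => ncomp (fst f) (snd q) \;o fmap (fst p) (snd f)) _ _).
- abstract (intros [F b]; simpl; now rewrite comp_idl, fmap_id).
- abstract (intros [F a] [G b] [H c] [t g] [s f]; simpl in *;
    rewrite fmap_comp, !comp_assoc; f_equal;
    rewrite <- !comp_assoc; f_equal; apply naturality).
Defined.

(* [fun_cat B Z] is the exponential of Z by B in Cat. *)
Definition is_exponential_fun_cat (B Z : Category) : Prop :=
  forall (W : Category) (F : Functor (W \xC B) Z),
    exists! G : Functor W (fun_cat B Z),
      eval_functor B Z \oF (G \xF id_functor B) = F.

(** * Pushouts in Cat and pushout products *)

Definition is_pushout (A B C P : Category) (f : Functor A B) (g : Functor A C)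
    (in1 : Functor B P) (in2 : Functor C P) : Prop :=
  in1 \oF f = in2 \oF g /\
  forall (T : Category) (p : Functor B T) (q : Functor C T),
    p \oF f = q \oF g ->
    exists! h : Functor P T, h \oF in1 = p /\ h \oF in2 = q.

(* k : P -> D x Y is (a representative of) the pushout product of u : C -> D
   and i : X -> Y: P is a pushout of D x X <- C x X -> C x Y and k is the
   functor induced by D x i and u x Y.  Pushouts exist, see [pushout_exists]. *)
Definition is_pushout_product (C D X Y : Category)
    (u : Functor C D) (i : Functor X Y) (P : Category) (k : Functor P (D \xC Y)) : Prop :=
  exists (in1 : Functor (D \xC X) P) (in2 : Functor (C \xC Y) P),
    is_pushout (u \xF id_functor X) (id_functor C \xF i) in1 in2 /\
    k \oF in1 = id_functor D \xF i /\
    k \oF in2 = u \xF id_functor Y.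

(** * Monoidal model structures on Cat, for the cartesian product *)

Definition functor_class : Type := forall A B : Category, Functor A B -> Prop.

(* k has the right lifting property with respect to j. *)
Definition has_rlp (A B : Category) (j : Functor A B) (X Y : Category)
    (k : Functor X Y) : Prop :=
  forall (a : Functor A X) (b : Functor B Y), k \oF a = b \oF j ->
    exists d : Functor B X, d \oF j = a /\ k \oF d = b.

Record ModelClasses := MkModelClasses {
  cof : functor_class;
  weq : functor_class;
  fib : functor_class
}.

Arguments cof _ {_ _} _.
Arguments weq _ {_ _} _.
Arguments fib _ {_ _} _.

Definition cofibrant (M : ModelClasses) (A : Category) : Prop :=
  cof M (from_initial A).

Definition pushout_product_axiom (M : ModelClasses) : Prop :=
  forall (C D X Y : Category) (u : Functor C D) (i : Functor X Y),
    cof M u -> cof M i ->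
    forall (P : Category) (k : Functor P (D \xC Y)),
      is_pushout_product u i k ->
      cof M k /\ (weq M u \/ weq M i -> weq M k).

(* Every cofibrant replacement Q -> 1 of the monoidal unit stays a weak
   equivalence after taking the product with a cofibrant object, on either side. *)
Definition unit_axiom (M : ModelClasses) : Prop :=
  forall (Q : Category) (q : Functor Q terminal_cat),
    cofibrant M Q -> weq M q ->
    forall X : Category, cofibrant M X ->
      weq M (q \xF id_functor X) /\ weq M (id_functor X \xF q).

(* What it takes for a model structure with classes [M] to be monoidal closed
   for the cartesian product; none of the conditions involves fibrations.
   The tensor product is the cartesian product, with internal hom [fun_cat]
   and unit [terminal_cat]. *)
Record cartesian_closed_model (M : ModelClasses) : Prop := {
  ccm_closed : forall B Z : Category, is_exponential_fun_cat B Z;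
  ccm_pushout_product : pushout_product_axiom M;
  ccm_unit : unit_axiom M;
  ccm_unit_cofibrant : cofibrant M terminal_cat
}.

(** * The model structure of groupoids *)

Definition injective_on_objects (A B : Category) (F : Functor A B) : Prop :=
  forall a a' : A, F a = F a' -> a = a'.

Definition groupoidal_weq (A B : Category) (F : Functor A B) : Prop :=
  forall Z : Category, is_groupoid Z -> is_equivalence (precomp F Z).

Definition groupoidal_fib (X Y : Category) (k : Functor X Y) : Prop :=
  forall (A B : Category) (j : Functor A B),
    injective_on_objects j -> groupoidal_weq j -> has_rlp j k.

Definition groupoidal_model : ModelClasses :=
  {| cof := injective_on_objects; weq := groupoidal_weq; fib := groupoidal_fib |}.

(** * Existence of pushouts in Cat *)

Definition hom_cast (A : Category) (a a' b b' : A) (e : a = a') (e' : b = b')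
    (f : hom a b) : hom a' b' :=
  match e in _ = x, e' in _ = y return hom x y with eq_refl, eq_refl => f end.

Lemma hom_cast_irr (A : Category) (a a' b b' : A) (e1 e2 : a = a') (e1' e2' : b = b')
    (f : hom a b) : hom_cast e1 e1' f = hom_cast e2 e2' f.
Proof.
now rewrite (proof_irrelevance _ e1 e2), (proof_irrelevance _ e1' e2').
Qed.

Lemma hom_cast_trans (A : Category) (a a' a'' b b' b'' : A) (e : a = a') (e1 : a' = a'')
    (e' : b = b') (e1' : b' = b'') (f : hom a b) :
  hom_cast e1 e1' (hom_cast e e' f) = hom_cast (eq_trans e e1) (eq_trans e' e1') f.
Proof. now destruct e1, e1', e, e'. Qed.

Lemma hom_cast_id (A : Category) (a a' : A) (e e' : a = a') :
  hom_cast e e' (idm a) = idm a'.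
Proof. now destruct e; rewrite (proof_irrelevance _ e' eq_refl). Qed.

Lemma hom_cast_comp (A : Category) (a a' b b' c c' : A) (ea : a = a') (eb : b = b')
    (ec : c = c') (g : hom b c) (f : hom a b) :
  hom_cast ea ec (g \;o f) = hom_cast eb ec g \;o hom_cast ea eb f.
Proof. now destruct ea, eb, ec. Qed.

Lemma functor_ext (A B : Category) (F G : Functor A B) (e : forall a, F a = G a) :
  (forall a b (f : hom a b), hom_cast (e a) (e b) (fmap F f) = fmap G f) -> F = G.
Proof.
destruct F as [F0 F1 F2 F3], G as [G0 G1 G2 G3]; simpl in *.
assert (E : F0 = G0) by (apply functional_extensionality; exact e).
subst G0; intros H.
assert (E : F1 = G1).
{ apply functional_extensionality_dep; intro a.
  apply functional_extensionality_dep; intro b.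
  apply functional_extensionality; intro f.
  rewrite <- H.
  now rewrite (proof_irrelevance _ (e a) eq_refl), (proof_irrelevance _ (e b) eq_refl). }
subst G1; f_equal; apply proof_irrelevance.
Qed.

Lemma functor_eq_obj (A B : Category) (F G : Functor A B) : F = G -> forall a, F a = G a.
Proof. now intros ->. Qed.

Lemma functor_eq_mor (A B : Category) (F G : Functor A B) : F = G ->
  forall a b (f : hom a b) (e : F a = G a) (e' : F b = G b),
    hom_cast e e' (fmap F f) = fmap G f.
Proof.
intros E; destruct E; intros.
now rewrite (proof_irrelevance _ e eq_refl), (proof_irrelevance _ e' eq_refl).
Qed.

(* Quotient of a type by an equivalence relation, as the subtype of chosen
   representatives. *)
Section Quotient.
Variables (T : Type) (R : T -> T -> Prop).
Hypotheses (Rrefl : forall x, R x x) (Rsym : forall x y, R x y -> R y x)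
  (Rtrans : forall x y z, R x y -> R y z -> R x z).

Definition canon (x : T) : T := epsilon (inhabits x) (R x).

Lemma canon_rel x : R x (canon x).
Proof. unfold canon; apply epsilon_spec; exists x; apply Rrefl. Qed.

Lemma canon_eq x y : R x y -> canon x = canon y.
Proof.
intros H; unfold canon.
rewrite (proof_irrelevance _ (inhabits y) (inhabits x)); f_equal.
apply functional_extensionality; intro z; apply propositional_extensionality.
split; intro K; eauto.
Qed.

Definition quot : Type := { x : T | canon x = x }.

Definition qclass (x : T) : quot :=
  exist _ (canon x) (eq_sym (canon_eq (canon_rel x))).

Definition qrep (x : quot) : T := proj1_sig x.

Lemma qrep_class x : R x (qrep (qclass x)).
Proof. apply canon_rel. Qed.

Lemma quot_ext (x y : quot) : qrep x = qrep y -> x = y.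
Proof.
destruct x as [x Hx], y as [y Hy]; simpl; intros E; subst y.
f_equal; apply proof_irrelevance.
Qed.

Lemma qclass_eq x y : R x y -> qclass x = qclass y.
Proof. intros H; apply quot_ext; simpl; now apply canon_eq. Qed.

Lemma qclass_rep x : qclass (qrep x) = x.
Proof. apply quot_ext; simpl; apply (proj2_sig x). Qed.

End Quotient.

Section Pushout.
Variables (A B C : Category) (f : Functor A B) (g : Functor A C).

Inductive glue : ob B + ob C -> ob B + ob C -> Prop :=
  Glue a : glue (inl (f a)) (inr (g a)).

Definition ob_rel := clos_refl_sym_trans _ glue.
Definition pob : Type := quot ob_rel.

Definition pcls (s : ob B + ob C) : pob :=
  qclass (rst_refl _ glue) (rst_sym _ glue) (rst_trans _ glue) s.

(* Formal composites of morphisms of B and C; the equations in [wl] and [wr]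
   avoid transports along the gluing of objects. *)
Inductive word : pob -> pob -> Type :=
| wid x : word x x
| wcomp x y z : word y z -> word x y -> word x z
| wl b b' x y : pcls (inl b) = x -> pcls (inl b') = y -> hom b b' -> word x y
| wr c c' x y : pcls (inr c) = x -> pcls (inr c') = y -> hom c c' -> word x y.

Inductive wrel : forall x y, word x y -> word x y -> Prop :=
| wrefl x y (w : word x y) : wrel w w
| wsym x y (w w' : word x y) : wrel w w' -> wrel w' w
| wtrans x y (w w' w'' : word x y) : wrel w w' -> wrel w' w'' -> wrel w w''
| wcong x y z (v v' : word y z) (w w' : word x y) :
    wrel v v' -> wrel w w' -> wrel (wcomp v w) (wcomp v' w')
| wassoc x y z t (u : word z t) (v : word y z) (w : word x y) :
    wrel (wcomp u (wcomp v w)) (wcomp (wcomp u v) w)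
| widl x y (w : word x y) : wrel (wcomp (wid y) w) w
| widr x y (w : word x y) : wrel (wcomp w (wid x)) w
| wl_id b x (e e' : pcls (inl b) = x) : wrel (wl e e' (idm b)) (wid x)
| wl_comp b b' b'' x y z (e : pcls (inl b) = x) (e' : pcls (inl b') = y)
    (e'' : pcls (inl b'') = z) (k : hom b' b'') (h : hom b b') :
    wrel (wl e e'' (k \;o h)) (wcomp (wl e' e'' k) (wl e e' h))
| wr_id c x (e e' : pcls (inr c) = x) : wrel (wr e e' (idm c)) (wid x)
| wr_comp c c' c'' x y z (e : pcls (inr c) = x) (e' : pcls (inr c') = y)
    (e'' : pcls (inr c'') = z) (k : hom c' c'') (h : hom c c') :
    wrel (wr e e'' (k \;o h)) (wcomp (wr e' e'' k) (wr e e' h))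
| wglue a a' x y (e : pcls (inl (f a)) = x) (e' : pcls (inl (f a')) = y)
    (d : pcls (inr (g a)) = x) (d' : pcls (inr (g a')) = y) (h : hom a a') :
    wrel (wl e e' (fmap f h)) (wr d d' (fmap g h)).

Definition phom (x y : pob) : Type := quot (@wrel x y).

Definition hcls (x y : pob) (w : word x y) : phom x y :=
  qclass (@wrefl x y) (@wsym x y) (@wtrans x y) w.

Lemma hcls_eq x y (w w' : word x y) : wrel w w' -> hcls w = hcls w'.
Proof. apply qclass_eq. Qed.

Lemma hcls_rep x y (h : phom x y) : hcls (qrep h) = h.
Proof. apply qclass_rep. Qed.

Lemma rep_hcls x y (w : word x y) : wrel (qrep (hcls w)) w.
Proof.
exact (wsym (qrep_class (@wrefl x y) (@wsym x y) (@wtrans x y) w)).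
Qed.

Definition pcomp (x y z : pob) (k : phom y z) (h : phom x y) : phom x z :=
  hcls (wcomp (qrep k) (qrep h)).

Lemma pcomp_hcls x y z (v : word y z) (w : word x y) :
  pcomp (hcls v) (hcls w) = hcls (wcomp v w).
Proof. apply hcls_eq, wcong; apply rep_hcls. Qed.

Definition pushout : Category.
Proof.
refine (@MkCategory pob phom (fun x => hcls (wid x)) pcomp _ _ _).
- abstract (intros x y z t w v u;
    rewrite <- (hcls_rep u), <- (hcls_rep v), <- (hcls_rep w), !pcomp_hcls;
    apply hcls_eq, wassoc).
- abstract (intros x y u; rewrite <- (hcls_rep u), pcomp_hcls; apply hcls_eq, widl).
- abstract (intros x y u; rewrite <- (hcls_rep u), pcomp_hcls; apply hcls_eq, widr).
Defined.

Definition pushout_in1 : Functor B pushout.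
Proof.
refine (@MkFunctor B pushout (fun b => pcls (inl b))
  (fun b b' h => hcls (wl eq_refl eq_refl h)) _ _).
- abstract (intros; apply hcls_eq, wl_id).
- abstract (intros; simpl; rewrite pcomp_hcls; apply hcls_eq, wl_comp).
Defined.

Definition pushout_in2 : Functor C pushout.
Proof.
refine (@MkFunctor C pushout (fun c => pcls (inr c))
  (fun c c' h => hcls (wr eq_refl eq_refl h)) _ _).
- abstract (intros; apply hcls_eq, wr_id).
- abstract (intros; simpl; rewrite pcomp_hcls; apply hcls_eq, wr_comp).
Defined.

Lemma pcls_glue a : pcls (inl (f a)) = pcls (inr (g a)).
Proof. apply qclass_eq, rst_step; constructor. Qed.

Lemma cast_hcls x x' y y' (e : x = x') (e' : y = y') (w : word x y) :
  @hom_cast pushout _ _ _ _ e e' (hcls w) =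
  hcls (match e in _ = s, e' in _ = t return word s t with eq_refl, eq_refl => w end).
Proof. now destruct e, e'. Qed.

Lemma pushout_square : pushout_in1 \oF f = pushout_in2 \oF g.
Proof.
apply (@functor_ext A pushout (pushout_in1 \oF f) (pushout_in2 \oF g) pcls_glue).
intros a b h; simpl; rewrite cast_hcls; apply hcls_eq.
refine (wtrans _ (wglue (pcls_glue a) (pcls_glue b) eq_refl eq_refl h)).
destruct (pcls_glue a), (pcls_glue b); apply wrefl.
Qed.

Section Desc.
Variables (T : Category) (p : Functor B T) (q : Functor C T).
Hypothesis pq : p \oF f = q \oF g.

Definition pre_obj (s : ob B + ob C) : T :=
  match s with inl b => p b | inr c => q c end.

Lemma pre_obj_rel s t : ob_rel s t -> pre_obj s = pre_obj t.
Proof.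
induction 1 as [x y [a]| | |]; simpl; try congruence.
exact (functor_eq_obj pq a).
Qed.

Definition desc_obj (x : pob) : T := pre_obj (qrep x).

Lemma desc_obj_cls s x : pcls s = x -> pre_obj s = desc_obj x.
Proof.
intros <-; apply pre_obj_rel.
exact (qrep_class (rst_refl _ glue) (rst_sym _ glue) (rst_trans _ glue) s).
Qed.

Fixpoint desc_word (x y : pob) (w : word x y) : hom (desc_obj x) (desc_obj y) :=
  match w in word x y return hom (desc_obj x) (desc_obj y) with
  | wid x => idm (desc_obj x)
  | wcomp v w => desc_word v \;o desc_word w
  | @wl b b' x y e e' h =>
      @hom_cast T (p b) _ (p b') _ (desc_obj_cls e) (desc_obj_cls e') (fmap p h)
  | @wr c c' x y e e' h =>
      @hom_cast T (q c) _ (q c') _ (desc_obj_cls e) (desc_obj_cls e') (fmap q h)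
  end.

Lemma desc_word_rel x y (w w' : word x y) : wrel w w' -> desc_word w = desc_word w'.
Proof.
induction 1; simpl; try congruence.
- apply comp_assoc.
- apply comp_idl.
- apply comp_idr.
- now rewrite fmap_id, hom_cast_id.
- rewrite fmap_comp; apply hom_cast_comp.
- now rewrite fmap_id, hom_cast_id.
- rewrite fmap_comp; apply hom_cast_comp.
- pose proof (@functor_eq_mor _ _ _ _ pq _ _ h
    (functor_eq_obj pq a) (functor_eq_obj pq a')) as E; simpl in E.
  rewrite <- E, hom_cast_trans; apply hom_cast_irr.
Qed.

Lemma desc_hcls x y (w : word x y) : desc_word (qrep (hcls w)) = desc_word w.
Proof. apply desc_word_rel, rep_hcls. Qed.

Definition desc : Functor pushout T.
Proof.
refine (@MkFunctor pushout T desc_obj (fun x y h => desc_word (qrep h)) _ _).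
- abstract (intro x; apply desc_hcls).
- abstract (intros x y z k h; apply desc_hcls).
Defined.

Lemma desc_in1 : desc \oF pushout_in1 = p.
Proof.
apply (@functor_ext B T (desc \oF pushout_in1) p
  (fun b => eq_sym (@desc_obj_cls (inl b) _ eq_refl))).
intros b b' h; unfold comp_functor, pushout_in1, desc; cbn [fmap fobj].
rewrite desc_hcls; cbn [desc_word]; rewrite hom_cast_trans.
now rewrite (hom_cast_irr _ eq_refl _ eq_refl).
Qed.

Lemma desc_in2 : desc \oF pushout_in2 = q.
Proof.
apply (@functor_ext C T (desc \oF pushout_in2) q
  (fun c => eq_sym (@desc_obj_cls (inr c) _ eq_refl))).
intros c c' h; unfold comp_functor, pushout_in2, desc; cbn [fmap fobj].
rewrite desc_hcls; cbn [desc_word]; rewrite hom_cast_trans.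
now rewrite (hom_cast_irr _ eq_refl _ eq_refl).
Qed.

End Desc.

Lemma pushout_functors_eq (T : Category) (h h' : Functor pushout T) :
  h \oF pushout_in1 = h' \oF pushout_in1 ->
  h \oF pushout_in2 = h' \oF pushout_in2 -> h = h'.
Proof.
intros E1 E2.
assert (e : forall x : pob, h x = h' x).
{ intro x; assert (K : pcls (qrep x) = x) by apply qclass_rep.
  destruct K; destruct (qrep x) as [b|c].
  - exact (functor_eq_obj E1 b).
  - exact (functor_eq_obj E2 c). }
apply (@functor_ext pushout T h h' e).
intros x y k; rewrite <- (hcls_rep k); generalize (qrep k) as w; clear k.
induction w as [x|x y z v IHv w IHw|b b' x y e1 e2 k|c c' x y e1 e2 k].
- change (hcls (wid x)) with (idm (x : pushout)).
  rewrite !fmap_id; apply hom_cast_id.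
- rewrite <- pcomp_hcls.
  change (pcomp (hcls v) (hcls w)) with
    (@comp pushout x y z (hcls v) (hcls w)).
  rewrite !fmap_comp, <- IHv, <- IHw; apply hom_cast_comp.
- destruct e1, e2; exact (functor_eq_mor E1 k (e _) (e _)).
- destruct e1, e2; exact (functor_eq_mor E2 k (e _) (e _)).
Qed.

Theorem pushout_is_pushout : is_pushout f g pushout_in1 pushout_in2.
Proof.
split; [exact pushout_square|].
intros T p q pq; exists (desc pq); split.
- split; [apply desc_in1 | apply desc_in2].
- intros h [H1 H2]; apply pushout_functors_eq.
  + now rewrite desc_in1, H1.
  + now rewrite desc_in2, H2.
Qed.

End Pushout.

Theorem pushout_exists (A B C : Category) (f : Functor A B) (g : Functor A C) :
  exists (P : Category) (in1 : Functor B P) (in2 : Functor C P), is_pushout f g in1 in2.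
Proof.
exists (pushout f g), (pushout_in1 f g), (pushout_in2 f g); apply pushout_is_pushout.
Qed.

(* Main.v *)
From Stdlib Require Import PropExtensionality.
From Stdlib Require Import ProofIrrelevance Classical ClassicalEpsilon.
Require Import Defs.

Set Implicit Arguments.
Unset Strict Implicit.
Unset Printing Implicit Defensive.

(** Cartesian closedness of Cat and the unit conditions come from currying:
    [[A x X, Z]] is isomorphic to [[A, [X, Z]]], naturally in [A], and [[X, Z]]
    is a groupoid when [Z] is.  Hence taking the product with a fixed category
    preserves weak equivalences ([weq_prod_id], [weq_id_prod]), which is the unit
    axiom and more.

    For the pushout product of [u : C -> D] and [i : X -> Y], let [P] be the
    pushout of [D x X <- C x X -> C x Y] and [k : P -> D x Y] the induced functor.
    On objects, the pushout is covered by its two legs, and injectivity of [k]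
    is a check in four cases ([pushout_product_injective]).

    If [u] is acyclic, then so is the cofibration [u x X], and the leg
    [in2 : C x Y -> P] is its cobase change.  Granting that acyclic cofibrations
    are stable under cobase change, [in2] is a weak equivalence; so is
    [k in2 = u x Y]; and two-out-of-three gives [k].  The case of [i] is the same
    with the other leg.

    The stability under cobase change ([pushout_acyclic_cofibration]) is obtained
    by describing acyclic cofibrations [F : A -> B] through lifting conditions
    in the 1-category Cat.  For a groupoid [Z], essential surjectivity of [[F, Z]]
    improves, as [F] is injective on objects, to the strict extension of functors
    [A -> Z] along [F] ([acyclic_cofibration_extension]).  Full faithfulness of
    [[F, Z]] says that [F] lifts uniquely against [(dom, cod) : Z^2 -> Z x Z],
    where [Z^2] is the category of arrows of [Z], since natural transformations
    are functors into [Z^2] ([precomp_ff_iff_arrow_lifting]).  Both conditions pass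
    through a pushout by its universal property alone. *)

(** * Composition of functors *)

Lemma comp_functor_assoc (A B C D : Category) (H : Functor C D) (G : Functor B C)
    (F : Functor A B) : H \oF (G \oF F) = H \oF G \oF F.
Proof.
now apply (@functor_ext A D (H \oF (G \oF F)) (H \oF G \oF F) (fun a => eq_refl)).
Qed.

(** * Isomorphisms and equivalences of categories *)

Lemma inverse_of_comp (A : Category) (a b c : A) (f : hom a b) (f' : hom b a)
    (g : hom b c) (g' : hom c b) :
  inverse_of f f' -> inverse_of g g' -> inverse_of (g \;o f) (f' \;o g').
Proof.
intros [H1 H2] [K1 K2]; split.
- now rewrite <- comp_assoc, (comp_assoc g' g f), K1, comp_idl.
- now rewrite <- comp_assoc, (comp_assoc f f' g'), H2, comp_idl.
Qed.

Lemma isomorphic_refl (A : Category) (a : A) : isomorphic a a.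
Proof. now exists (idm a), (idm a); split; rewrite comp_idl. Qed.

Lemma isomorphic_trans (A : Category) (a b c : A) :
  isomorphic a b -> isomorphic b c -> isomorphic a c.
Proof.
intros (f & f' & Hf) (g & g' & Hg); exists (g \;o f), (f' \;o g').
now apply inverse_of_comp.
Qed.

Lemma fmap_inverse_of (A B : Category) (F : Functor A B) (a b : A) (f : hom a b)
    (g : hom b a) : inverse_of f g -> inverse_of (fmap F f) (fmap F g).
Proof. intros [H1 H2]; split; now rewrite <- fmap_comp, ?H1, ?H2, fmap_id. Qed.

Lemma fmap_isomorphic (A B : Category) (F : Functor A B) (a b : A) :
  isomorphic a b -> isomorphic (F a) (F b).
Proof.
intros (f & g & H); exists (fmap F f), (fmap F g); now apply fmap_inverse_of.
Qed.

(** The pointwise inverses are automatically natural. *)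
Lemma is_iso_pointwise (A B : Category) (F G : fun_cat A B) (t : hom F G) :
  (forall a, is_iso (ncomp t a)) -> is_iso t.
Proof.
intros H.
pose (s a := proj1_sig (constructive_indefinite_description _ (H a))).
assert (Hs : forall a, inverse_of (ncomp t a) (s a)).
{ intro a; unfold s; now destruct (constructive_indefinite_description _ (H a)). }
assert (N : forall a b (f : hom a b), s b \;o fmap G f = fmap F f \;o s a).
{ intros a b f.
  rewrite <- (comp_idr (fmap G f)), <- (proj2 (Hs a)), (comp_assoc (fmap G f)).
  rewrite <- (naturality t), !comp_assoc, (proj1 (Hs b)).
  now rewrite comp_idl. }
exists (MkNatTrans N); split; apply nat_trans_ext; intro a; apply (Hs a).
Qed.

Lemma isomorphic_pointwise (A B : Category) (F G : fun_cat A B) :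
  isomorphic F G ->
  exists (t : NatTrans F G) (s : NatTrans G F), forall a, inverse_of (t a) (s a).
Proof.
intros (t & s & H1 & H2); exists t, s; intro a; split.
- exact (f_equal (fun r : NatTrans F F => r a) H1).
- exact (f_equal (fun r : NatTrans G G => r a) H2).
Qed.

Definition fully_faithful (A B : Category) (F : Functor A B) : Prop :=
  forall (a b : A) (g : hom (F a) (F b)), exists! f : hom a b, fmap F f = g.

Definition essentially_surjective (A B : Category) (F : Functor A B) : Prop :=
  forall b : B, exists a : A, isomorphic (F a) b.

Lemma fully_faithful_inj (A B : Category) (F : Functor A B) (a b : A) (f f' : hom a b) :
  fully_faithful F -> fmap F f = fmap F f' -> f = f'.
Proof.
intros H E; destruct (H a b (fmap F f')) as (x & _ & U).
now rewrite <- (U f), <- (U f').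
Qed.

Lemma fully_faithful_isomorphic (A B : Category) (F : Functor A B) (a b : A) :
  fully_faithful F -> isomorphic (F a) (F b) -> isomorphic a b.
Proof.
intros H (g & g' & H1 & H2).
destruct (H _ _ g) as (f & E & _), (H _ _ g') as (f' & E' & _).
exists f, f'; split; apply (fully_faithful_inj H);
  now rewrite fmap_comp, E, E', fmap_id.
Qed.

(** [f] is recovered from [G F f] by conjugating with the components of [s]. *)
Lemma faithful_of_retraction (A B : Category) (F : Functor A B) (G : Functor B A)
    (s : NatTrans (G \oF F) (id_functor A)) (s' : NatTrans (id_functor A) (G \oF F)) :
  (forall a, inverse_of (s a) (s' a)) ->
  forall a b (f f' : hom a b), fmap F f = fmap F f' -> f = f'.
Proof.
intros Hs a b.
assert (K : forall f : hom a b, f = s b \;o fmap G (fmap F f) \;o s' a).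
{ intro f; pose proof (naturality s f) as N; pose proof (proj2 (Hs a)) as I.
  simpl in N, I |- *; rewrite N, <- comp_assoc, I; symmetry; apply comp_idr. }
intros f f' E; now rewrite (K f), (K f'), E.
Qed.

(** A preimage of [g] is [G g] conjugated by the isomorphism [G F => 1]; that [F]
    sends it to [g] may be tested after applying the faithful functor [G]. *)
Lemma equivalence_fully_faithful (A B : Category) (F : Functor A B) :
  is_equivalence F -> fully_faithful F.
Proof.
intros (G & HA & HB).
destruct (isomorphic_pointwise HA) as (s & s' & Hs).
destruct (isomorphic_pointwise HB) as (r & r' & Hr).
pose proof (faithful_of_retraction Hr) as FG.
intros a b g; exists (s b \;o fmap G g \;o s' a); split.
- apply FG.
  pose proof (naturality s (s b \;o fmap G g \;o s' a)) as N.
  pose proof (proj1 (Hs b)) as I; pose proof (proj1 (Hs a)) as J.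
  simpl in N, I, J |- *.
  rewrite <- (comp_idl (fmap G (fmap F _))), <- I, <- comp_assoc, N.
  rewrite <- !comp_assoc, J, comp_idr.
  now rewrite comp_assoc, I, comp_idl.
- intros f <-.
  pose proof (naturality s f) as N; pose proof (proj2 (Hs a)) as I.
  simpl in N, I |- *; rewrite N, <- comp_assoc, I; apply comp_idr.
Qed.

Lemma equivalence_essentially_surjective (A B : Category) (F : Functor A B) :
  is_equivalence F -> essentially_surjective F.
Proof.
intros (G & _ & HB) b; exists (G b).
destruct (isomorphic_pointwise HB) as (r & r' & Hr).
exists (r b), (r' b); apply Hr.
Qed.

(** By the axiom of choice: the inverse picks a preimage of each object up to an
    isomorphism [r b], and full faithfulness determines everything else. *)
Lemma equivalence_of_ff_es (A B : Category) (F : Functor A B) :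
  fully_faithful F -> essentially_surjective F -> is_equivalence F.
Proof.
intros FF ES.
pose (g b := proj1_sig (constructive_indefinite_description _ (ES b))).
assert (Hg : forall b, isomorphic (F (g b)) b).
{ intro b; unfold g; now destruct (constructive_indefinite_description _ (ES b)). }
pose (r b := proj1_sig (constructive_indefinite_description _ (Hg b))).
assert (Hr : forall b, is_iso (r b)).
{ intro b; unfold r; now destruct (constructive_indefinite_description _ (Hg b)). }
pose (r' b := proj1_sig (constructive_indefinite_description _ (Hr b))).
assert (Hr' : forall b, inverse_of (r b) (r' b)).
{ intro b; unfold r'; now destruct (constructive_indefinite_description _ (Hr b)). }
pose (lift a b (h : hom (F a) (F b)) :=
  proj1_sig (constructive_indefinite_description _ (FF a b h))).
assert (Hl : forall a b (h : hom (F a) (F b)), fmap F (lift a b h) = h).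
{ intros a b h; unfold lift.
  now destruct (constructive_indefinite_description _ (FF a b h)) as [x []]. }
(* The action of the inverse functor on morphisms, forced by the requirement
   that [r] be natural. *)
pose (m b c (h : hom b c) := lift (g b) (g c) (r' c \;o h \;o r b)).
assert (Em : forall b c (h : hom b c), r c \;o fmap F (m b c h) = h \;o r b).
{ intros b c h; unfold m.
  now rewrite Hl, !comp_assoc, (proj2 (Hr' c)), comp_idl. }
assert (m_id : forall b, m b b (idm b) = idm (g b)).
{ intro b; apply (fully_faithful_inj FF); unfold m.
  rewrite Hl, comp_idr, fmap_id; apply Hr'. }
assert (m_comp : forall b c d (k : hom c d) (h : hom b c),
  m b d (k \;o h) = m c d k \;o m b c h).
{ intros b c d k h; apply (fully_faithful_inj FF); unfold m.
  rewrite fmap_comp, !Hl, <- !comp_assoc; do 2 f_equal.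
  now rewrite !comp_assoc, (proj2 (Hr' c)), comp_idl. }
pose (G := @MkFunctor B A g m m_id m_comp).
exists G; split.
- assert (N : forall a b (f : hom a b),
    lift (g (F b)) b (r (F b)) \;o m (F a) (F b) (fmap F f)
    = f \;o lift (g (F a)) a (r (F a))).
  { intros a b f; apply (fully_faithful_inj FF).
    rewrite !fmap_comp, !Hl; apply Em. }
  exists (@MkNatTrans A A (G \oF F) (id_functor A) (fun a => lift (g (F a)) a (r (F a))) N).
  apply is_iso_pointwise; intro a; simpl.
  exists (lift a (g (F a)) (r' (F a))).
  split; apply (fully_faithful_inj FF); rewrite fmap_comp, !Hl, fmap_id; apply Hr'.
- exists (@MkNatTrans B B (F \oF G) (id_functor B) r Em).
  apply is_iso_pointwise; exact Hr.
Qed.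

Lemma equivalence_comp (A B C : Category) (G : Functor B C) (F : Functor A B) :
  is_equivalence G -> is_equivalence F -> is_equivalence (G \oF F).
Proof.
intros HG HF; apply equivalence_of_ff_es.
- intros a b h.
  destruct (equivalence_fully_faithful HG h) as (g & Eg & Ug).
  destruct (equivalence_fully_faithful HF g) as (f & Ef & Uf).
  exists f; split; [simpl; now rewrite Ef|].
  intros f' E; apply Uf; symmetry; now apply Ug.
- intro c; destruct (equivalence_essentially_surjective HG c) as [b Hb].
  destruct (equivalence_essentially_surjective HF b) as [a Ha].
  exists a; exact (isomorphic_trans (fmap_isomorphic G Ha) Hb).
Qed.

Lemma equivalence_cancel_left (A B C : Category) (G : Functor B C) (F : Functor A B) :
  is_equivalence G -> is_equivalence (G \oF F) -> is_equivalence F.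
Proof.
intros HG HGF.
pose proof (equivalence_fully_faithful HG) as FG.
apply equivalence_of_ff_es.
- intros a b g.
  destruct (equivalence_fully_faithful HGF (fmap G g)) as (f & E & U).
  exists f; split; [exact (fully_faithful_inj FG E)|].
  intros f' <-; now apply U.
- intro b; destruct (equivalence_essentially_surjective HGF (G b)) as [a Ha].
  exists a; exact (fully_faithful_isomorphic FG Ha).
Qed.

(** The strict equality of the two composites is available in all the squares
    of functor categories considered here, thanks to [uncurry_inj]. *)
Lemma equivalence_of_square (A B A' B' : Category) (F : Functor A B)
    (F' : Functor A' B') (V : Functor A A') (W : Functor B B') :
  W \oF F = F' \oF V ->
  is_equivalence V -> is_equivalence W -> is_equivalence F' -> is_equivalence F.
Proof.
intros E HV HW HF'; apply (equivalence_cancel_left HW).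
rewrite E; now apply equivalence_comp.
Qed.

(** * Currying *)

Lemma fmap_prod_split (A B Z : Category) (F : Functor (A \xC B) Z) (a a' : A) (b b' : B)
    (f : hom a a') (g : hom b b') :
  @fmap _ _ F (a, b) (a', b') (f, g)
  = @fmap _ _ F (a, b') (a', b') (f, idm b') \;o @fmap _ _ F (a, b) (a, b') (idm a, g).
Proof. rewrite <- fmap_comp; simpl; now rewrite comp_idl, comp_idr. Qed.

Lemma fmap_prod_split' (A B Z : Category) (F : Functor (A \xC B) Z) (a a' : A) (b b' : B)
    (f : hom a a') (g : hom b b') :
  @fmap _ _ F (a, b) (a', b') (f, g)
  = @fmap _ _ F (a', b) (a', b') (idm a', g) \;o @fmap _ _ F (a, b) (a', b) (f, idm b).
Proof. rewrite <- fmap_comp; simpl; now rewrite comp_idl, comp_idr. Qed.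

Definition curry_obj (W B Z : Category) (F : Functor (W \xC B) Z) (w : W) : Functor B Z.
Proof.
refine (@MkFunctor B Z (fun b => F (w, b))
  (fun b b' g => @fmap _ _ F (w, b) (w, b') (idm w, g)) _ _).
- abstract (intro b; exact (fmap_id F (w, b))).
- abstract (intros b c d g f; rewrite <- fmap_comp; simpl; now rewrite comp_idl).
Defined.

Definition curry_mor (W B Z : Category) (F : Functor (W \xC B) Z) (w w' : W)
    (f : hom w w') : NatTrans (curry_obj F w) (curry_obj F w').
Proof.
refine (@MkNatTrans B Z (curry_obj F w) (curry_obj F w')
  (fun b => @fmap _ _ F (w, b) (w', b) (f, idm b)) _).
abstract (intros b c g; simpl; now rewrite <- fmap_prod_split, <- fmap_prod_split').
Defined.

Definition curry (W B Z : Category) (F : Functor (W \xC B) Z) : Functor W (fun_cat B Z).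
Proof.
refine (@MkFunctor W (fun_cat B Z) (curry_obj F) (curry_mor F) _ _).
- abstract (intro w; apply nat_trans_ext; intro b; exact (fmap_id F (w, b))).
- abstract (intros u v w g f; apply nat_trans_ext; intro b; simpl;
    rewrite <- fmap_comp; simpl; now rewrite comp_idl).
Defined.

Definition uncurry (W B Z : Category) (G : Functor W (fun_cat B Z)) : Functor (W \xC B) Z :=
  eval_functor B Z \oF (G \xF id_functor B).

Lemma uncurry_curry (W B Z : Category) (F : Functor (W \xC B) Z) : uncurry (curry F) = F.
Proof.
unshelve eapply functor_ext; [now intros [w b]|].
intros [w b] [w' b'] [f g]; symmetry; exact (fmap_prod_split F f g).
Qed.

(** Together with the irrelevance of casts, this removes the casts along
    equalities of functors that are the identity on objects. *)
Lemma hom_cast_component (A B : Category) (F F' G G' : fun_cat A B) (e : F = F')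
    (e' : G = G') (t : hom F G) (a : A) :
  ncomp (hom_cast e e' t) a
  = hom_cast (functor_eq_obj e a) (functor_eq_obj e' a) (ncomp t a).
Proof. destruct e, e'; symmetry; exact (hom_cast_irr _ eq_refl _ eq_refl _). Qed.

Lemma curry_uncurry (W B Z : Category) (G : Functor W (fun_cat B Z)) :
  curry (uncurry G) = G.
Proof.
assert (E : forall w, curry (uncurry G) w = G w :> Functor B Z).
{ intro w.
  apply (@functor_ext B Z (curry (uncurry G) w) (G w) (fun b => eq_refl)).
  intros b c g; simpl; rewrite fmap_id; apply comp_idl. }
apply (@functor_ext W (fun_cat B Z) _ _ E).
intros w w' f; apply nat_trans_ext; intro b.
rewrite hom_cast_component, (hom_cast_irr _ eq_refl _ eq_refl); simpl.
change (ncomp (fmap G f) b \;o fmap (G w : Functor B Z) (idm b) = ncomp (fmap G f) b).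
rewrite fmap_id; apply comp_idr.
Qed.

Lemma fun_cat_exponential (B Z : Category) : is_exponential_fun_cat B Z.
Proof.
intros W F; exists (curry F); split; [exact (uncurry_curry F)|].
intros G <-; exact (curry_uncurry G).
Qed.

Definition curry_nat (W B Z : Category) (F G : Functor (W \xC B) Z) (t : NatTrans F G) :
  NatTrans (curry F) (curry G).
Proof.
unshelve refine (@MkNatTrans W (fun_cat B Z) (curry F) (curry G) (fun w =>
  @MkNatTrans B Z (curry_obj F w) (curry_obj G w) (fun b => t (w, b)) _) _).
- abstract (intros b c g; apply (naturality t)).
- abstract (intros w w' f; apply nat_trans_ext; intro b; apply (naturality t)).
Defined.

Definition curry_functor (W B Z : Category) :
  Functor (fun_cat (W \xC B) Z) (fun_cat W (fun_cat B Z)).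
Proof.
refine (@MkFunctor (fun_cat (W \xC B) Z) (fun_cat W (fun_cat B Z))
  (@curry W B Z) (@curry_nat W B Z) _ _).
- abstract (intro F; apply nat_trans_ext; intro w; now apply nat_trans_ext).
- abstract (intros F G H s t; apply nat_trans_ext; intro w; now apply nat_trans_ext).
Defined.

(** Naturality in two variables can be checked in each variable separately, and
    each functor [W -> [B, Z]] is strictly in the image of currying. *)
Lemma curry_functor_equivalence (W B Z : Category) : is_equivalence (curry_functor W B Z).
Proof.
apply equivalence_of_ff_es.
- intros F G t.
  pose (s := fun p : W \xC B =>
    match p return hom (F p) (G p) with (w, b) => ncomp (ncomp t w) b end).
  assert (N : forall p q (f : hom p q), s q \;o fmap F f = fmap G f \;o s p).
  { intros [w b] [w' b'] [f g]; simpl in f, g.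
    rewrite (fmap_prod_split F), (fmap_prod_split G), comp_assoc.
    pose proof (f_equal (fun r : NatTrans _ _ => r b') (naturality t f)) as E1.
    pose proof (naturality (ncomp t w) g) as E2; simpl in E1, E2 |- *.
    rewrite E1, <- !comp_assoc; f_equal; exact E2. }
  exists (MkNatTrans N); split.
  + apply nat_trans_ext; intro w; now apply nat_trans_ext.
  + intros r <-; apply nat_trans_ext; now intros [w b].
- intro G; exists (uncurry G); simpl; rewrite curry_uncurry; apply isomorphic_refl.
Qed.

(** * Stability of weak equivalences *)

Lemma fun_cat_groupoid (X Z : Category) : is_groupoid Z -> is_groupoid (fun_cat X Z).
Proof. intros HZ F G t; apply is_iso_pointwise; intro a; apply HZ. Qed.

(** A way to prove equalities of functors with values in a functor category: once
    uncurried, the two sides agree definitionally on objects, so that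
    [functor_ext] involves no casts. *)
Lemma uncurry_inj (W B Z : Category) (F G : Functor W (fun_cat B Z)) :
  uncurry F = uncurry G -> F = G.
Proof. intros E; now rewrite <- (curry_uncurry F), <- (curry_uncurry G), E. Qed.

Lemma precomp_curry (A B X Z : Category) (F : Functor A B) :
  curry_functor A X Z \oF precomp (F \xF id_functor X) Z
  = precomp F (fun_cat X Z) \oF curry_functor B X Z.
Proof.
do 2 apply uncurry_inj.
unshelve eapply functor_ext; [reflexivity|].
intros [[G a] x] [[H b] y] [[t f] g]; simpl; now rewrite !fmap_id.
Qed.

Lemma precomp_comp (A B C Z : Category) (G : Functor B C) (F : Functor A B) :
  precomp F Z \oF precomp G Z = precomp (G \oF F) Z.
Proof. apply uncurry_inj; now unshelve eapply functor_ext. Qed.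

(** Testing [F x X] against the groupoid [Z] amounts to testing [F] against
    [[X, Z]]. *)
Lemma weq_prod_id (A B X : Category) (F : Functor A B) :
  groupoidal_weq F -> groupoidal_weq (F \xF id_functor X).
Proof.
intros HF Z HZ.
apply (equivalence_of_square (precomp_curry X Z F));
  [apply curry_functor_equivalence .. | apply HF, fun_cat_groupoid, HZ].
Qed.

Definition swap (A B : Category) : Functor (A \xC B) (B \xC A).
Proof.
refine (@MkFunctor (A \xC B) (B \xC A) (fun p => (snd p, fst p))
  (fun p q f => (snd f, fst f)) _ _); abstract reflexivity.
Defined.

Lemma swap_swap (A B : Category) : swap B A \oF swap A B = id_functor (A \xC B).
Proof.
unshelve eapply functor_ext; [now intros [a b]|].
now intros [a b] [a' b'] [f g].
Qed.

Lemma precomp_id (A Z : Category) : precomp (id_functor A) Z = id_functor (fun_cat A Z).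
Proof. apply uncurry_inj; now unshelve eapply functor_ext. Qed.

Lemma precomp_swap_equivalence (A B Z : Category) : is_equivalence (precomp (swap A B) Z).
Proof.
exists (precomp (swap B A) Z).
rewrite !precomp_comp, !swap_swap, !precomp_id; split; apply isomorphic_refl.
Qed.

Lemma weq_id_prod (A B X : Category) (F : Functor A B) :
  groupoidal_weq F -> groupoidal_weq (id_functor X \xF F).
Proof.
intros HF Z HZ.
assert (E : (id_functor X \xF F) \oF swap A X = swap B X \oF (F \xF id_functor X))
  by now unshelve eapply functor_ext.
refine (equivalence_of_square _ (precomp_swap_equivalence B X Z)
  (precomp_swap_equivalence A X Z) (weq_prod_id X HF HZ)).
now rewrite !precomp_comp, E.
Qed.

Lemma weq_cancel_right (A B C : Category) (G : Functor B C) (F : Functor A B) :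
  groupoidal_weq F -> groupoidal_weq (G \oF F) -> groupoidal_weq G.
Proof.
intros HF HGF Z HZ; apply (equivalence_cancel_left (HF Z HZ)).
rewrite precomp_comp; now apply HGF.
Qed.

(** * Natural transformations as functors to the arrow category *)

(** Definitional eta for arrows lets functors into the arrow category be compared
    by [functor_ext] with trivial casts. *)
Set Primitive Projections.
Record arrow (Z : Category) := Arrow {
  arr_dom : Z;
  arr_cod : Z;
  arr_mor : hom arr_dom arr_cod
}.

Record arrow_square (Z : Category) (x y : arrow Z) := ArrowSquare {
  sq_dom : hom (arr_dom x) (arr_dom y);
  sq_cod : hom (arr_cod x) (arr_cod y);
  sq_comm : arr_mor y \;o sq_dom = sq_cod \;o arr_mor x
}.
Unset Primitive Projections.

Lemma arrow_square_ext (Z : Category) (x y : arrow Z) (f g : arrow_square x y) :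
  sq_dom f = sq_dom g -> sq_cod f = sq_cod g -> f = g.
Proof.
destruct f as [f1 f2 Hf], g as [g1 g2 Hg]; simpl; intros E1 E2; subst.
f_equal; apply proof_irrelevance.
Qed.

Definition arrow_id (Z : Category) (x : arrow Z) : arrow_square x x.
Proof.
refine (@ArrowSquare Z x x (idm _) (idm _) _).
abstract (now rewrite comp_idl, comp_idr).
Defined.

Definition arrow_comp (Z : Category) (x y z : arrow Z) (g : arrow_square y z)
    (f : arrow_square x y) : arrow_square x z.
Proof.
refine (@ArrowSquare Z x z (sq_dom g \;o sq_dom f) (sq_cod g \;o sq_cod f) _).
abstract (now rewrite comp_assoc, sq_comm, <- comp_assoc, sq_comm, comp_assoc).
Defined.

Definition arrow_cat (Z : Category) : Category.
Proof.
refine (@MkCategory (arrow Z) (@arrow_square Z) (@arrow_id Z) (@arrow_comp Z) _ _ _).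
- abstract (intros; apply arrow_square_ext; apply comp_assoc).
- abstract (intros; apply arrow_square_ext; apply comp_idl).
- abstract (intros; apply arrow_square_ext; apply comp_idr).
Defined.

Definition dom_functor (Z : Category) : Functor (arrow_cat Z) Z :=
  @MkFunctor (arrow_cat Z) Z (@arr_dom Z) (@sq_dom Z)
    (fun _ => eq_refl) (fun _ _ _ _ _ => eq_refl).

Definition cod_functor (Z : Category) : Functor (arrow_cat Z) Z :=
  @MkFunctor (arrow_cat Z) Z (@arr_cod Z) (@sq_cod Z)
    (fun _ => eq_refl) (fun _ _ _ _ _ => eq_refl).

Definition arrow_of_nat (A Z : Category) (G H : Functor A Z) (t : NatTrans G H) :
  Functor A (arrow_cat Z).
Proof.
refine (@MkFunctor A (arrow_cat Z) (fun a => Arrow (t a))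
  (fun a b f => @ArrowSquare Z (Arrow (t a)) (Arrow (t b)) (fmap G f) (fmap H f)
     (naturality t f)) _ _).
- abstract (intro a; apply arrow_square_ext; apply fmap_id).
- abstract (intros; apply arrow_square_ext; apply fmap_comp).
Defined.

Lemma dom_arrow_of_nat (A Z : Category) (G H : Functor A Z) (t : NatTrans G H) :
  dom_functor Z \oF arrow_of_nat t = G.
Proof. now unshelve eapply functor_ext. Qed.

Lemma cod_arrow_of_nat (A Z : Category) (G H : Functor A Z) (t : NatTrans G H) :
  cod_functor Z \oF arrow_of_nat t = H.
Proof. now unshelve eapply functor_ext. Qed.

Lemma arrow_of_nat_whisker (A B Z : Category) (F : Functor A B) (G H : Functor B Z)
    (t : NatTrans G H) : arrow_of_nat (whisker F t) = arrow_of_nat t \oF F.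
Proof.
unshelve eapply functor_ext; [reflexivity|].
intros; now apply arrow_square_ext.
Qed.

(** Two equal arrows have equal underlying morphisms up to a cast along their
    ends; here the ends agree already, which makes the cast trivial. *)
Lemma arrow_of_nat_inj (A Z : Category) (G H : Functor A Z) (s t : NatTrans G H) :
  arrow_of_nat s = arrow_of_nat t -> s = t.
Proof.
intros E; apply nat_trans_ext; intro a.
pose proof (functor_eq_obj E a) as Ea; simpl in Ea.
assert (K : forall (x y : arrow Z) (e : x = y),
  hom_cast (f_equal (@arr_dom Z) e) (f_equal (@arr_cod Z) e) (arr_mor x) = arr_mor y)
  by now intros x y [].
specialize (K _ _ Ea); simpl in K; rewrite <- K.
now rewrite (hom_cast_irr _ eq_refl _ eq_refl).
Qed.

Lemma arrow_of_nat_surj (A Z : Category) (G H : Functor A Z) (K : Functor A (arrow_cat Z)) :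
  dom_functor Z \oF K = G -> cod_functor Z \oF K = H ->
  exists t : NatTrans G H, arrow_of_nat t = K.
Proof.
intros <- <-.
exists (@MkNatTrans A Z (dom_functor Z \oF K) (cod_functor Z \oF K)
  (fun a => arr_mor (K a)) (fun a b f => sq_comm (fmap K f))).
unshelve eapply functor_ext; [reflexivity|].
intros; now apply arrow_square_ext.
Qed.

(** Unique lifting of [F] against [(dom, cod) : Z^2 -> Z x Z], where a functor
    into [Z x Z] is given by its two components. *)
Definition unique_arrow_lifting (A B Z : Category) (F : Functor A B) : Prop :=
  forall (G H : Functor B Z) (K : Functor A (arrow_cat Z)),
    dom_functor Z \oF K = G \oF F -> cod_functor Z \oF K = H \oF F ->
    exists! L : Functor B (arrow_cat Z),
      L \oF F = K /\ dom_functor Z \oF L = G /\ cod_functor Z \oF L = H.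

(** Natural transformations [G => H] are the functors into the arrow category with
    domain [G] and codomain [H], and whiskering with [F] is composition with [F].
    In this form full faithfulness is an orthogonality condition, hence
    stable under cobase change. *)
Lemma precomp_ff_iff_arrow_lifting (A B Z : Category) (F : Functor A B) :
  fully_faithful (precomp F Z) <-> unique_arrow_lifting Z F.
Proof.
split.
- intros FF G H K E1 E2.
  destruct (arrow_of_nat_surj E1 E2) as [s <-].
  destruct (FF G H s) as (t & Et & U); simpl in Et.
  exists (arrow_of_nat t); split.
  + rewrite <- arrow_of_nat_whisker, Et.
    now rewrite dom_arrow_of_nat, cod_arrow_of_nat.
  + intros L (EL & D & C); destruct (arrow_of_nat_surj D C) as [r <-].
    f_equal; apply U; simpl; apply arrow_of_nat_inj.
    now rewrite arrow_of_nat_whisker.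
- intros UL G H s.
  destruct (UL G H (arrow_of_nat (s : NatTrans (G \oF F) (H \oF F)))) as (L & (EL & D & C) & U).
  + apply dom_arrow_of_nat.
  + apply cod_arrow_of_nat.
  + destruct (arrow_of_nat_surj D C) as [t <-].
    exists t; split.
    * simpl; apply arrow_of_nat_inj; now rewrite arrow_of_nat_whisker.
    * intros r <-; apply arrow_of_nat_inj, U.
      now rewrite <- arrow_of_nat_whisker, dom_arrow_of_nat, cod_arrow_of_nat.
Qed.

(** * Acyclic cofibrations *)

Definition extension_property (A B Z : Category) (F : Functor A B) : Prop :=
  forall p : Functor A Z, exists G : Functor B Z, G \oF F = p.

(** An isomorphism with source [z], together with its target. *)
Record iso_from (Z : Category) (z : Z) := IsoFrom {
  if_ob : Z;
  if_mor : hom z if_ob;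
  if_inv : hom if_ob z;
  if_spec : inverse_of if_mor if_inv
}.

Definition iso_from_id (Z : Category) (z : Z) : iso_from z :=
  IsoFrom (conj (comp_idl (idm z)) (comp_idl (idm z))).

(** Replacing each value of a functor by an isomorphic object, and conjugating its
    action on morphisms accordingly. *)
Definition transported_functor (B Z : Category) (G : Functor B Z)
    (c : forall b, iso_from (G b)) : Functor B Z.
Proof.
refine (@MkFunctor B Z (fun b => if_ob (c b))
  (fun a b f => if_mor (c b) \;o fmap G f \;o if_inv (c a)) _ _).
- abstract (intro b; rewrite fmap_id, comp_idr; apply (if_spec (c b))).
- abstract (intros x y z g f; rewrite fmap_comp, <- !comp_assoc; do 2 f_equal;
    rewrite !comp_assoc, (proj1 (if_spec (c y))), comp_idl; reflexivity).
Defined.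

(** [[F, Z]] is an isofibration: change [G b] into [p a] along the given
    isomorphism when [b = F a], and leave it alone when [b] is not in the image.
    Injectivity on objects makes [a] unique, so that the choice is consistent. *)
Lemma extension_up_to_iso_strict (A B Z : Category) (F : Functor A B) (G : Functor B Z)
    (p : Functor A Z) :
  injective_on_objects F -> @isomorphic (fun_cat A Z) (G \oF F) p ->
  exists G' : Functor B Z, G' \oF F = p.
Proof.
intros inj I; destruct (isomorphic_pointwise I) as (t & s & Hts).
pose (d a := IsoFrom (Hts a)).
(* The equation is required for all preimages [a] of [b], so that at [b = F a]
   it applies with [e] the reflexivity proof and no transport is left. *)
assert (Hc : forall b, exists x : iso_from (G b), forall a (e : F a = b),
  x = eq_rect (F a) (fun b => iso_from (G b)) (d a) b e).
{ intro b; destruct (classic (exists a, F a = b)) as [[a <-]|N].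
  - exists (d a); intros a' e; pose proof (inj _ _ e); subst a'.
    now rewrite (proof_irrelevance _ e eq_refl).
  - exists (iso_from_id (G b)); intros a e; elim N; now exists a. }
pose (c b := proj1_sig (constructive_indefinite_description _ (Hc b))).
assert (E : forall a, c (F a) = d a).
{ intro a; unfold c.
  destruct (constructive_indefinite_description _ (Hc (F a))) as [x Hx]; simpl.
  exact (Hx a eq_refl). }
exists (transported_functor c).
apply (@functor_ext A Z (transported_functor c \oF F) p
  (fun a => f_equal (@if_ob _ _) (E a))).
intros a b f; simpl.
generalize (E a), (E b); generalize (c (F a)), (c (F b)).
intros x y -> ->; simpl.
pose proof (naturality t f) as N; pose proof (proj2 (Hts a)) as J.
simpl in N, J; now rewrite N, <- comp_assoc, J, comp_idr.
Qed.

Lemma acyclic_cofibration_extension (A B Z : Category) (F : Functor A B) :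
  injective_on_objects F -> groupoidal_weq F -> is_groupoid Z -> extension_property Z F.
Proof.
intros inj HF HZ p.
destruct (equivalence_essentially_surjective (HF Z HZ) p) as [G I].
exact (extension_up_to_iso_strict inj I).
Qed.

Lemma weq_of_liftings (A B : Category) (F : Functor A B) :
  (forall Z, is_groupoid Z -> extension_property Z F /\ unique_arrow_lifting Z F) ->
  groupoidal_weq F.
Proof.
intros H Z HZ; destruct (H Z HZ) as [E U]; apply equivalence_of_ff_es.
- now apply precomp_ff_iff_arrow_lifting.
- intro p; destruct (E p) as [G <-]; exists G; apply isomorphic_refl.
Qed.

(** * Pushouts *)

(** Functors into a codiscrete category are just functions on objects; this
    is how the object sets of a pushout are reached from its universal property. *)
Definition codiscrete (S : Type) : Category.
Proof.
refine (@MkCategory S (fun _ _ => unit) (fun _ => tt) (fun _ _ _ _ _ => tt) _ _ _).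
- abstract reflexivity.
- abstract (now intros a b []).
- abstract (now intros a b []).
Defined.

Definition to_codiscrete (S : Type) (D : Category) (h : D -> S) : Functor D (codiscrete S) :=
  @MkFunctor D (codiscrete S) h (fun _ _ _ => tt)
    (fun _ => eq_refl) (fun _ _ _ _ _ => eq_refl).

Lemma to_codiscrete_ext (S : Type) (D : Category) (F G : Functor D (codiscrete S)) :
  (forall a, F a = G a) -> F = G.
Proof.
intros e; apply (functor_ext (e := e)); intros a b k.
now destruct (hom_cast _ _ _), (fmap G k).
Qed.

Section PushoutStability.
Variables (A B C P : Category) (f : Functor A B) (g : Functor A C)
  (in1 : Functor B P) (in2 : Functor C P).
Hypothesis po : is_pushout f g in1 in2.

Lemma is_pushout_sym : is_pushout g f in2 in1.
Proof.
destruct po as [E U]; split; [easy|].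
intros T p q pq; destruct (U T q p) as (h & [H1 H2] & Uh); [easy|].
exists h; split; [easy|]; intros h' []; now apply Uh.
Qed.

Lemma pushout_functor_ext (T : Category) (h h' : Functor P T) :
  h \oF in1 = h' \oF in1 -> h \oF in2 = h' \oF in2 -> h = h'.
Proof.
intros E1 E2; destruct po as [E U].
destruct (U T (h' \oF in1) (h' \oF in2)) as (x & _ & Ux).
- now rewrite <- !comp_functor_assoc, E.
- now rewrite <- (Ux h), <- (Ux h').
Qed.

Lemma pushout_desc (T : Category) (p : Functor B T) (q : Functor C T) :
  p \oF f = q \oF g -> exists h : Functor P T, h \oF in1 = p /\ h \oF in2 = q.
Proof. intros pq; destruct po as [_ U]; destruct (U T p q pq) as (h & H & _); eauto. Qed.

Lemma pushout_extension_property (Z : Category) :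
  extension_property Z f -> extension_property Z in2.
Proof.
intros H q; destruct (H (q \oF g)) as [p E].
destruct (pushout_desc E) as (h & _ & Eh); now exists h.
Qed.

(** Restrict the problem on [C] to [A], solve it uniquely on [B], and glue the
    solution with the given functor on [C].  The ends of the glued functor are the
    prescribed ones because they are so on both legs. *)
Lemma pushout_arrow_lifting (Z : Category) :
  unique_arrow_lifting Z f -> unique_arrow_lifting Z in2.
Proof.
intros UL G H K D C0; pose proof (proj1 po) as sq.
destruct (UL (G \oF in1) (H \oF in1) (K \oF g)) as (L1 & (E1 & D1 & C1) & U1).
- now rewrite comp_functor_assoc, D, <- !comp_functor_assoc, sq.
- now rewrite comp_functor_assoc, C0, <- !comp_functor_assoc, sq.
- destruct (pushout_desc E1) as (L & EL1 & EL2).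
  exists L; split; [split; [exact EL2|split]|].
  + apply pushout_functor_ext; rewrite <- comp_functor_assoc.
    * now rewrite EL1.
    * now rewrite EL2.
  + apply pushout_functor_ext; rewrite <- comp_functor_assoc.
    * now rewrite EL1.
    * now rewrite EL2.
  + intros L' (EK & <- & <-); apply pushout_functor_ext; [|now rewrite EL2].
    rewrite EL1; apply U1.
    now rewrite <- !comp_functor_assoc, sq, comp_functor_assoc, EK.
Qed.

Lemma pushout_acyclic_cofibration :
  injective_on_objects f -> groupoidal_weq f -> groupoidal_weq in2.
Proof.
intros inj Hf; apply weq_of_liftings; intros Z HZ; split.
- apply pushout_extension_property; now apply acyclic_cofibration_extension.
- apply pushout_arrow_lifting, precomp_ff_iff_arrow_lifting.
  apply equivalence_fully_faithful, Hf, HZ.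
Qed.

(** The predicate of being in the image of a leg, and the constantly true predicate,
    are functors to the codiscrete category on [Prop] that agree on both legs. *)
Lemma pushout_objects_covered (x : P) :
  (exists b, in1 b = x) \/ (exists c, in2 c = x).
Proof.
assert (E : to_codiscrete (fun _ : P => True) = to_codiscrete (fun y : P =>
  (exists b, in1 b = y) \/ (exists c, in2 c = y))).
{ apply pushout_functor_ext; apply to_codiscrete_ext; intro b; simpl;
    apply propositional_extensionality; split; eauto. }
pose proof (functor_eq_obj E x : True = _) as K; simpl in K.
now rewrite <- K.
Qed.

End PushoutStability.

(** * The pushout product axiom *)

(** In the mixed cases [k (in1 (d, x)) = k (in2 (c, y))] gives [d = u c] and
    [y = i x], and the square itself identifies the two objects. *)
Lemma pushout_product_injective (C D X Y : Category) (u : Functor C D) (i : Functor X Y)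
    (P : Category) (k : Functor P (D \xC Y)) :
  injective_on_objects u -> injective_on_objects i -> is_pushout_product u i k ->
  injective_on_objects k.
Proof.
intros Hu Hi (in1 & in2 & po & E1 & E2).
assert (K1 : forall d x, k (in1 (d, x)) = (d, i x))
  by (intros d x; exact (functor_eq_obj E1 (d, x))).
assert (K2 : forall c y, k (in2 (c, y)) = (u c, y))
  by (intros c y; exact (functor_eq_obj E2 (c, y))).
assert (S : forall c x, in1 (u c, x) = in2 (c, i x))
  by (intros c x; exact (functor_eq_obj (proj1 po) (c, x))).
intros p p' E.
destruct (pushout_objects_covered po p) as [[[d x] <-]|[[c y] <-]];
destruct (pushout_objects_covered po p') as [[[d' x'] <-]|[[c' y'] <-]];
  rewrite ?K1, ?K2 in E; injection E; clear E.
- now intros ->%Hi ->.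
- now intros <- ->.
- now intros -> <-.
- now intros -> ->%Hu.
Qed.

Lemma groupoidal_pushout_product : pushout_product_axiom groupoidal_model.
Proof.
intros C D X Y u i Hu Hi P k Hk; split.
- exact (pushout_product_injective Hu Hi Hk).
- destruct Hk as (in1 & in2 & po & E1 & E2); intros [H|H]; simpl in *.
  + apply (@weq_cancel_right _ _ _ k in2); [|rewrite E2; now apply weq_prod_id].
    apply (pushout_acyclic_cofibration po); [|now apply weq_prod_id].
    intros [c x] [c' x'] [= E ->]; now rewrite (Hu _ _ E).
  + apply (@weq_cancel_right _ _ _ k in1); [|rewrite E1; now apply weq_id_prod].
    apply (pushout_acyclic_cofibration (is_pushout_sym po)); [|now apply weq_id_prod].
    intros [c x] [c' x'] [= -> E]; now rewrite (Hi _ _ E).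
Qed.

Theorem theorem2p24 : cartesian_closed_model groupoidal_model.
Proof.
split.
- exact fun_cat_exponential.
- exact groupoidal_pushout_product.
- intros Q q _ Hq X _; split; [now apply weq_prod_id | now apply weq_id_prod].
- intros [].
Qed.
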